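(* Let $\mathbb{F}$ be a field and let $(V_\bullet,W_\bullet,\phi_\bullet)$ be a ladder persistence module of length $\ell+1$ over $\mathbb{F}$ such that neither the barcode of $V_\bullet$ nor the barcode of $W_\bullet$ contains a pair of strictly nested bars. Then there are non-negative integers $r_{[i_1,j_1]}^{[i_2,j_2]}$ (for $[i_1,j_1]\preceq[i_2,j_2]$) and $d_{ij}^{+},d_{ij}^{-}$ (for $0\le i\le j\le\ell$) and an isomorphism of ladder persistence modules $$(V_\bullet,W_\bullet,\phi_\bullet)\;\simeq\bigoplus_{[i_1,j_1]\preceq[i_2,j_2]}\Big(\mathbf{R}_{[i_1,j_1]_\bullet}^{[i_2,j_2]}\Big)^{r_{[i_1,j_1]}^{[i_2,j_2]}}\oplus\bigoplus_{i\le j}\big(\mathbf{I}^{+}[i,j]_\bullet\big)^{d_{ij}^{+}}\oplus\bigoplus_{i\le j}\big(\mathbf{I}^{-}[i,j]_\bullet\big)^{d_{ij}^{-}}.$$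
   Context: A persistence module of length $\ell+1$ is a sequence $V_0\xrightarrow{f_1}V_1\to\cdots\xrightarrow{f_\ell}V_\ell$ of finite-dimensional $\mathbb{F}$-vector spaces and linear maps. For $0\le i\le j\le \ell$, the interval module $\mathbf{I}[i,j]_\bullet$ has $\mathbb{F}$ in positions $i,\dots,j$, $0$ elsewhere, and identity maps between consecutive copies of $\mathbb{F}$. Every persistence module is isomorphic to $\bigoplus_{i\le j}\mathbf{I}[i,j]_\bullet^{d_{ij}}$ for unique $d_{ij}\ge0$; its barcode is the set of intervals (bars) $[i,j]$ with $d_{ij}>0$. A ladder persistence module $(V_\bullet,W_\bullet,\phi_\bullet)$ of length $\ell+1$ consists of persistence modules $(V_\bullet,f_\bullet)$ and $(W_\bullet,h_\bullet)$ of length $\ell+1$ and linear maps $\phi_i:V_i\to W_i$ with $\phi_i\circ f_i=h_i\circ\phi_{i-1}$ for $1\le i\le\ell$. Direct sums are pointwise; an isomorphism is a pair of isomorphisms of persistence modules $V_\bullet\cong V'_\bullet$, $W_\bullet\cong W'_\bullet$ intertwining the maps $\phi_\bullet$ and $\phi'_\bullet$. Relation: $[a,b]\preceq[c,d]$ iff $a\le c\le b\le d$. A bar $[i_2,j_2]$ is strictly nested in $[i_1,j_1]$ if $i_1<i_2\le j_2<j_1$. Special ladder modules: for $[i_1,j_1]\preceq[i_2,j_2]$, $\mathbf{R}_{[i_1,j_1]_\bullet}^{[i_2,j_2]}$ has $V_\bullet=\mathbf{I}[i_2,j_2]_\bullet$, $W_\bullet=\mathbf{I}[i_1,j_1]_\bullet$,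 and $\phi_k=1:\mathbb{F}\to\mathbb{F}$ for $k\in[i_1,j_1]\cap[i_2,j_2]$, $\phi_k=0$ otherwise. $\mathbf{I}^{+}[i,j]_\bullet$ has $V_\bullet=\mathbf{I}[i,j]_\bullet$ and $W_\bullet=0$. $\mathbf{I}^{-}[i,j]_\bullet$ has $V_\bullet=0$ and $W_\bullet=\mathbf{I}[i,j]_\bullet$. *)

(* Defs.v *)
From HB Require Import structures.
From mathcomp Require Import all_boot all_order all_algebra.

Set Implicit Arguments.
Unset Strict Implicit.
Unset Printing Implicit Defensive.

Import GRing.Theory.
Local Open Scope ring_scope.

(* A module of length l.+1 has positions 'I_l.+1; its l structure maps are    *)
(* indexed by i : 'I_l, the i-th one going from position i to position i + 1, *)
(* so that pm_map V i is the map written f_(i+1) on paper.                    *)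
Definition src l (i : 'I_l) : 'I_l.+1 := widen_ord (leqnSn l) i.
Definition tgt l (i : 'I_l) : 'I_l.+1 := lift ord0 i.

Record pmod (F : fieldType) (l : nat) := PMod {
  pm_obj :> 'I_l.+1 -> vectType F;
  pm_map : forall i : 'I_l, 'Hom(pm_obj (src i), pm_obj (tgt i)) }.

Definition is_pmhom (F : fieldType) l (V W : pmod F l)
    (g : forall k, 'Hom(V k, W k)) : Prop :=
  forall i : 'I_l, (g (tgt i) \o pm_map V i = pm_map W i \o g (src i))%VF.

Definition is_pmiso (F : fieldType) l (V W : pmod F l)
    (g : forall k, 'Hom(V k, W k)) : Prop :=
  is_pmhom g /\ forall k, bijective (g k).

Definition pm_iso (F : fieldType) l (V W : pmod F l) : Prop :=
  exists g : forall k, 'Hom(V k, W k), is_pmiso g.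

Definition pm_zero (F : fieldType) l : pmod F l :=
  @PMod F l (fun=> 'rV[F]_0) (fun=> 0).

Section HomSum.
Variables (F : fieldType) (U V U' V' : vectType F).
Variables (f : 'Hom(U, V)) (g : 'Hom(U', V')).

Definition hom_sum_fun (u : U * U') : V * V' := (f u.1, g u.2).

Fact hom_sum_fun_linear : linear hom_sum_fun.
Proof. by move=> a u v; rewrite /hom_sum_fun /= !linearP. Qed.

HB.instance Definition _ :=
  GRing.isLinear.Build F (U * U')%type (V * V')%type _ hom_sum_fun
    hom_sum_fun_linear.

Definition hom_sum : 'Hom((U * U')%type, (V * V')%type) := linfun hom_sum_fun.

Lemma hom_sumE u : hom_sum u = (f u.1, g u.2).
Proof. by rewrite lfunE. Qed.

End HomSum.

Definition pm_oplus (F : fieldType) l (V W : pmod F l) : pmod F l :=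
  @PMod F l (fun k => (V k * W k)%type)
    (fun i => hom_sum (pm_map V i) (pm_map W i)).

Definition pm_pow (F : fieldType) l (V : pmod F l) (n : nat) : pmod F l :=
  iter n (pm_oplus V) (pm_zero F l).

(* The pair b stands for the interval [b.1, b.2].                             *)
Definition pinterval (l : nat) : Type :=
  {b : 'I_l.+1 * 'I_l.+1 | (b.1 <= b.2)%N}.
HB.instance Definition _ l := Finite.on (pinterval l).

Definition lo l (b : pinterval l) : nat := (val b).1.
Definition hi l (b : pinterval l) : nat := (val b).2.

Definition in_interval l (b : pinterval l) (k : 'I_l.+1) : bool :=
  (lo b <= k <= hi b)%N.

Definition preceq l (b c : pinterval l) : bool :=
  [&& lo b <= lo c, lo c <= hi b & hi b <= hi c]%N.

Definition strictly_nested l (b c : pinterval l) : bool :=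
  [&& lo c < lo b, lo b <= hi b & hi b < hi c]%N.

(* With m, n <= 1, 'rV[F]_m is F or 0, and this map is the identity of F when *)
(* m = n = 1 and zero otherwise.                                              *)
Definition id_or_0 (F : fieldType) (m n : nat) : 'Hom('rV[F]_m, 'rV[F]_n) :=
  linfun (mulmxr (pid_mx 1 : 'M[F]_(m, n))).

Lemma id_or_0E (F : fieldType) (m n : nat) (u : 'rV[F]_m) :
  id_or_0 F m n u = u *m pid_mx 1.
Proof. by rewrite lfunE. Qed.

(* The boolean in_interval b k is used as the dimension, 0 or 1.              *)
Definition interval_pmod (F : fieldType) l (b : pinterval l) : pmod F l :=
  @PMod F l (fun k => 'rV[F]_(in_interval b k))
    (fun i => id_or_0 F (in_interval b (src i)) (in_interval b (tgt i))).

Definition is_bar_decomp (F : fieldType) l (V : pmod F l)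
    (d : pinterval l -> nat) : Prop :=
  pm_iso V (\big[@pm_oplus F l/pm_zero F l]_(b : pinterval l)
              pm_pow (interval_pmod F b) (d b)).

(* By the structure theorem d exists and is unique, so quantifying d          *)
(* existentially here amounts to speaking of the multiplicities of V.         *)
Definition in_barcode (F : fieldType) l (V : pmod F l) (b : pinterval l) :
    Prop :=
  exists2 d : pinterval l -> nat, is_bar_decomp V d & (0 < d b)%N.

Definition no_strictly_nested_bars (F : fieldType) l (V : pmod F l) : Prop :=
  forall b c : pinterval l,
    in_barcode V b -> in_barcode V c -> ~~ strictly_nested b c.

Record ladder (F : fieldType) (l : nat) := Ladder {
  lad_V : pmod F l;
  lad_W : pmod F l;
  lad_phi : forall k, 'Hom(lad_V k, lad_W k);
  lad_phiP : is_pmhom lad_phi }.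

Definition ladder_iso (F : fieldType) l (L L' : ladder F l) : Prop :=
  exists (g : forall k, 'Hom(lad_V L k, lad_V L' k))
         (h : forall k, 'Hom(lad_W L k, lad_W L' k)),
    [/\ is_pmiso g, is_pmiso h &
        forall k, (h k \o lad_phi L k = lad_phi L' k \o g k)%VF].

Fact zero_phiP (F : fieldType) l (V W : pmod F l) :
  @is_pmhom F l V W (fun=> 0).
Proof. by move=> i; rewrite comp_lfun0l comp_lfun0r. Qed.

Definition ladder_zero (F : fieldType) l : ladder F l :=
  Ladder (@zero_phiP F l (pm_zero F l) (pm_zero F l)).

Fact oplus_phiP (F : fieldType) l (L L' : ladder F l) :
  @is_pmhom F l (pm_oplus (lad_V L) (lad_V L')) (pm_oplus (lad_W L) (lad_W L'))
    (fun k => hom_sum (lad_phi L k) (lad_phi L' k)).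
Proof.
move=> i; apply/lfunP => u; rewrite !comp_lfunE /= !hom_sumE /=.
by rewrite -!comp_lfunE !lad_phiP.
Qed.

Definition ladder_oplus (F : fieldType) l (L L' : ladder F l) : ladder F l :=
  Ladder (oplus_phiP L L').

Definition ladder_pow (F : fieldType) l (L : ladder F l) (n : nat) :
    ladder F l :=
  iter n (ladder_oplus L) (ladder_zero F l).

Definition ladder_plus (F : fieldType) l (b : pinterval l) : ladder F l :=
  Ladder (@zero_phiP F l (interval_pmod F b) (pm_zero F l)).

Definition ladder_minus (F : fieldType) l (b : pinterval l) : ladder F l :=
  Ladder (@zero_phiP F l (pm_zero F l) (interval_pmod F b)).

Definition preceq_pair (l : nat) : Type :=
  {p : pinterval l * pinterval l | preceq p.1 p.2}.
HB.instance Definition _ l := Finite.on (preceq_pair l).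

Fact R_phiP (F : fieldType) l (p : preceq_pair l) :
  @is_pmhom F l (interval_pmod F (val p).2) (interval_pmod F (val p).1)
    (fun k => id_or_0 F (in_interval (val p).2 k) (in_interval (val p).1 k)).
Proof.
case: p => -[b c] /= /and3P[bc cb hh] i.
apply/lfunP => u; rewrite !comp_lfunE /= !id_or_0E -!mulmxA.
congr (_ *m _).
have : in_interval c (src i) -> in_interval b (tgt i) ->
    in_interval c (tgt i) && in_interval b (src i).
  rewrite /in_interval /= /bump /= => /andP[h1 h2] /andP[h3 h4].
  rewrite add1n in h3 h4 *; apply/andP; split; apply/andP; split.
  - exact: leq_trans h1 (leqnSn _).
  - exact: leq_trans h4 hh.
  - exact: leq_trans bc h1.
  - exact: leq_trans (leqnSn _) h4.
case: (in_interval c (src i)); last by rewrite !flatmx0.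
case: (in_interval b (tgt i)); last by rewrite !thinmx0.
by move=> /(_ isT isT)/andP[-> ->].
Qed.

(* p.1 is the lower index [i1, j1] of R and p.2 the upper index [i2, j2].     *)
Definition ladder_R (F : fieldType) l (p : preceq_pair l) : ladder F l :=
  Ladder (@R_phiP F l p).

(* Main.v *)
Require Import Defs.
From HB Require Import structures.
From mathcomp Require Import all_boot all_order all_algebra.

Set Implicit Arguments.
Unset Strict Implicit.
Unset Printing Implicit Defensive.

Import GRing.Theory.
Local Open Scope ring_scope.

(* Call V unnested if, whenever some class born before position i is alive at *)
(* j, every class at i that vanishes at j also comes from an earlier class.   *)
(* Modules without nested bars are unnested, and this basis-free condition    *)
(* passes to direct summands, so it suffices to split off one summand and to  *)
(* induct on the total dimension.                                             *)
(*   Let a be the first position with V_a <> 0 and [a, j] the shortest bar of *)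
(* V born there, generated by v. Unnestedness makes V_k -> V_j injective for  *)
(* all a <= k <= j. If phi v = 0, the bar [a, j] splits off as I+. Otherwise  *)
(* phi v is the image of some y in W_i with i minimal, and its last nonzero   *)
(* image is at some j' <= j; unnestedness of W yields a functional xi on W_j' *)
(* that is 1 on y and kills all classes born before i, and by injectivity     *)
(* xi o phi extends to V_j. Then (v, y) and (xi o phi, xi) define a section   *)
(* and a retraction that split off R with bars [i, j'] and [a, j]. If V = 0,  *)
(* any earliest bar of W splits off as I-.                                    *)

(** Barcodes enter only once. In an interval decomposition, provided by [pm_decomp], a nonzero map
    from position [i - 1] to [j] forces a bar through both positions. A class at [i] that is zero at
    [j] and does not come from [i - 1] would then need a bar strictly nested in that one. Hence
    [no_nested_unnested].

    After that no basis is chosen. A generator together with a functional ([is_bar]) makes a bar a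
    direct summand ([is_bar_hom]). If such data on both sides commute with [phi], then
    [ladder_split] yields a complementary ladder, which is again unnested by [retract_unnested]. The
    data are found in [split_plus_or_R]. A generator [v] of earliest birth in [V] leaves no older
    classes for its functional to kill. Taking the shortest such bar makes [V_a] inject up to its
    end, and [unnested_inj] spreads this injectivity over the whole bar. [bar_through] supplies the
    matching bar of [W] when [phi v] is nonzero. The induction is [unnested_decomposable]. *)

Definition lfun_of (F : fieldType) (U V : vectType F) (f : U -> V)
    (lf : linear f) : 'Hom(U, V) :=
  linfun (HB.pack_for {linear U -> V} f (GRing.isLinear.Build F U V _ f lf)).

Lemma lfun_ofE (F : fieldType) (U V : vectType F) (f : U -> V)
  (lf : linear f) u : lfun_of lf u = f u.
Proof. by rewrite lfunE. Qed.

Lemma tgt_val l (i : 'I_l) : tgt i = i.+1 :> nat.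
Proof. by []. Qed.

Lemma tgt_inj l : injective (@tgt l).
Proof. exact: lift_inj. Qed.

Lemma ord0_or_tgt l (k : 'I_l.+1) : k = ord0 \/ exists i, k = tgt i.
Proof. by case: (unliftP ord0 k) => [i ->|->]; [right; exists i|left]. Qed.

Lemma ord_max_or_src l (k : 'I_l.+1) : k = ord_max \/ exists i, k = src i.
Proof.
case: (unliftP ord_max k) => [i ->|->]; [right; exists i|by left].
by apply: val_inj; rewrite /= /bump leqNgt ltn_ord.
Qed.

Lemma ord_tgt_ind l (j : 'I_l.+1) (P : 'I_l.+1 -> Prop) :
  P j -> (forall i : 'I_l, (j <= src i)%N -> P (src i) -> P (tgt i)) ->
  forall k : 'I_l.+1, (j <= k)%N -> P k.
Proof.
move=> Pj Ps k; move: {2}(k : nat) (erefl (k : nat)) => n.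
elim: n k => [|n IH] k ek jk.
  have kj : (k <= j)%N by rewrite ek.
  by rewrite (_ : k = j) //; apply/val_inj/eqP; rewrite eqn_leq jk kj.
case: (eqVneq j k) => [<- //|jNk].
have {}jk : (j < k)%N by rewrite ltn_neqAle jNk.
case: (ord0_or_tgt k) ek jk {jNk} => [-> //|[i ->]] [ei]; rewrite ltnS => ji.
by apply: Ps => //; apply: IH.
Qed.

(** * Transition maps *)

Section Transition.
Variables (F : fieldType) (l : nat).
Implicit Types V W A B : pmod F l.

(** Even with [j = k] provable, [V j] and [V k] are different types, so the identity is transported
    along the equality proof; such proofs are unique for ordinals, whence [cast_pm_id]. *)
Definition cast_pm V (j k : 'I_l.+1) : 'Hom(V j, V k) :=
  if j =P k is ReflectT e then ecast k' 'Hom(V j, V k') e \1%VF else 0.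

Lemma cast_pm_id V j : cast_pm V j j = \1%VF.
Proof. by rewrite /cast_pm; case: eqP => // e; rewrite eq_axiomK. Qed.

Lemma cast_pm_neq V j k : j != k -> cast_pm V j k = 0.
Proof. by rewrite /cast_pm; case: eqP. Qed.

(* The transition map V_j -> V_(j+n); it is 0 unless k = j + n, which lets    *)
(* all positions be treated uniformly, without transporting along j + n = k.  *)
Fixpoint steps V (n : nat) (j k : 'I_l.+1) : 'Hom(V j, V k) :=
  if n is n'.+1 then
    \sum_(i < l)
      (cast_pm V (tgt i) k \o (pm_map V i \o steps V n' j (src i)))%VF
  else cast_pm V j k.

(** For [k < j] the difference truncates to 0 and the cast between distinct positions vanishes, so
    the map is 0 there. *)
Definition trans V (j k : 'I_l.+1) : 'Hom(V j, V k) := steps V (k - j) j k.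

Lemma trans_id V j : trans V j j = \1%VF.
Proof. by rewrite /trans subnn /= cast_pm_id. Qed.

Lemma trans_gt V (j k : 'I_l.+1) : (k < j)%N -> trans V j k = 0.
Proof.
move=> kj; rewrite /trans (eqP (ltnW kj)) /= cast_pm_neq //.
by apply: contraTneq kj => ->; rewrite ltnn.
Qed.

Lemma trans_tgt V (j : 'I_l.+1) (i : 'I_l) : (j <= src i)%N ->
  trans V j (tgt i) = (pm_map V i \o trans V j (src i))%VF.
Proof.
move=> ji; rewrite /trans tgt_val subSn //= (bigD1 i) //=.
rewrite cast_pm_id comp_lfun1l.
(* [tgt] is injective, so only the summand of index [i] survives. *)
rewrite big1 ?addr0 // => i' i'i.
by rewrite cast_pm_neq ?comp_lfun0l // (inj_eq (@tgt_inj l)).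
Qed.

Lemma trans_map V (i : 'I_l) : trans V (src i) (tgt i) = pm_map V i.
Proof. by rewrite trans_tgt // trans_id comp_lfun1r. Qed.

Lemma trans_comp V (i j k : 'I_l.+1) u : (i <= j)%N -> (j <= k)%N ->
  trans V j k (trans V i j u) = trans V i k u.
Proof.
move=> ij; move: k; apply: ord_tgt_ind => [|i' ji' IH].
  by rewrite trans_id lfunE.
by rewrite !trans_tgt ?comp_lfunE ?IH // (leq_trans ij).
Qed.

Lemma trans_src V (i : 'I_l) (k : 'I_l.+1) u : (tgt i <= k)%N ->
  trans V (src i) k u = trans V (tgt i) k (pm_map V i u).
Proof. by move=> ik; rewrite -trans_map trans_comp //= tgt_val leqW. Qed.

Lemma trans_hom V W (g : forall k, 'Hom(V k, W k)) j k u : is_pmhom g ->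
  g k (trans V j k u) = trans W j k (g j u).
Proof.
move=> hg; case: (ltnP k j) => [kj|].
  by rewrite !trans_gt // !lfunE linear0.
move: k; apply: ord_tgt_ind => [|i ji IH]; first by rewrite !trans_id !lfunE.
by rewrite !trans_tgt // !comp_lfunE -IH -comp_lfunE hg comp_lfunE.
Qed.

Lemma trans_oplus V W j k u :
  trans (pm_oplus V W) j k u = (trans V j k u.1, trans W j k u.2).
Proof.
case: (ltnP k j) => [kj|]; first by rewrite !trans_gt // !lfunE.
move: k; apply: ord_tgt_ind => [|i ji IH].
  by rewrite !trans_id !lfunE; case: u.
by rewrite !trans_tgt // !comp_lfunE IH /= hom_sumE.
Qed.

(* A basis-free form of the absence of nested bars.                           *)
Definition unnested V := forall (i : 'I_l) (j : 'I_l.+1), (tgt i <= j)%N ->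
  trans V (src i) j != 0 -> (lker (trans V (tgt i) j) <= limg (pm_map V i))%VS.

(** Expresses that [K] is a direct summand of [V] without naming a complement. *)
Definition pm_retract (V K : pmod F l) := exists (s : forall k, 'Hom(K k, V k))
  (r : forall k, 'Hom(V k, K k)),
  [/\ is_pmhom s, is_pmhom r & forall k, (r k \o s k)%VF = \1%VF].

Lemma retract_trans_eq0 V K j k :
  pm_retract V K -> trans V j k = 0 -> trans K j k = 0.
Proof.
move=> [s [r [hs hr rs]]] V0; apply/lfunP => u.
rewrite -[LHS]id_lfunE -rs comp_lfunE (trans_hom _ _ hs) V0.
by rewrite !lfunE linear0.
Qed.

(** If [u] dies at [j], so does [s u]; then [s u] is the image of some [v], and [u = r (s u)] is the
    image of [r v]. *)
Lemma retract_lker_limg V K (i : 'I_l) (j : 'I_l.+1) : pm_retract V K ->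
  (lker (trans V (tgt i) j) <= limg (pm_map V i))%VS ->
  (lker (trans K (tgt i) j) <= limg (pm_map K i))%VS.
Proof.
move=> [s [r [hs hr rs]]] /subvP sV.
apply/subvP => u; rewrite memv_ker => /eqP u0.
have /sV/memv_imgP[v _ sv] : s _ u \in lker (trans V (tgt i) j).
  by rewrite memv_ker -trans_hom // u0 linear0.
rewrite -[u]id_lfunE -rs comp_lfunE sv -comp_lfunE hr comp_lfunE.
exact: memv_img (memvf _).
Qed.

Lemma retract_unnested V K : pm_retract V K -> unnested V -> unnested K.
Proof.
move=> VK nV i j ij K0; apply: (retract_lker_limg VK); apply: nV => //.
by apply: contraNneq K0 => /(retract_trans_eq0 VK) ->.
Qed.

(** [unnested] is not stable under sums, as a bar of one summand may be nested in a bar of the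
    other; its conclusion for fixed [i] and [j] is. *)
Lemma oplus_lker_limg V W (i : 'I_l) (j : 'I_l.+1) :
  (lker (trans V (tgt i) j) <= limg (pm_map V i))%VS ->
  (lker (trans W (tgt i) j) <= limg (pm_map W i))%VS ->
  (lker (trans (pm_oplus V W) (tgt i) j) <= limg (pm_map (pm_oplus V W) i))%VS.
Proof.
move=> /subvP hV /subvP hW; apply/subvP => -[u w].
rewrite memv_ker trans_oplus /=.
move=> /eqP[/eqP]; rewrite -memv_ker => /hV/memv_imgP[u' _ ->] /eqP.
rewrite -memv_ker => /hW/memv_imgP[w' _ ->].
apply/memv_imgP; exists (u', w'); rewrite ?memvf //.
exact/esym/hom_sumE.
Qed.

End Transition.

(** * Isomorphisms *)

Section BigUpToEquivalence.
Variables (T : Type) (op : T -> T -> T) (z : T) (R : T -> T -> Prop).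
Hypothesis R_refl : forall a, R a a.
Hypothesis R_sym : forall a b, R a b -> R b a.
Hypothesis R_trans : forall b a c, R a b -> R b c -> R a c.
Hypothesis op_cong :
  forall a a' b b', R a a' -> R b b' -> R (op a b) (op a' b').
Hypothesis opC : forall a b, R (op a b) (op b a).
Hypothesis opA : forall a b c, R (op a (op b c)) (op (op a b) c).
Hypothesis op0 : forall a, R (op z a) a.

Lemma equiv_opCA a b c : R (op a (op b c)) (op b (op a c)).
Proof.
apply: R_trans (opA a b c) _; apply: R_trans (op_cong (opC a b) (R_refl c)) _.
exact/R_sym/opA.
Qed.

Lemma equiv_big_iter0 (I : finType) (X : I -> T) :
  R (\big[op/z]_(i : I) iter 0 (op (X i)) z) z.
Proof.
elim: (index_enum I) => [|i e IH]; first by rewrite big_nil; apply: R_refl.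
by rewrite big_cons; apply: R_trans IH; apply: op0.
Qed.

(** Direct sums form a commutative monoid only up to isomorphism, hence the relation [R]. The extra
    [X p] is moved past the other terms by [equiv_opCA] until index [p] is met. *)
Lemma equiv_big_iterS (I : finType) (X : I -> T) (d : I -> nat) p :
  R (op (X p) (\big[op/z]_(i : I) iter (d i) (op (X i)) z))
    (\big[op/z]_(i : I) iter ((i == p) + d i) (op (X i)) z).
Proof.
elim: (index_enum I) (mem_index_enum p) (index_enum_uniq I) => // i e IH.
rewrite inE !big_cons => /orP[/eqP ->|pe] /= /andP[ie ue].
  rewrite eqxx.
  (* The enumeration has no repetition, so the multiplicities in the tail are unchanged. *)
  rewrite [X in R _ (op _ X)](eq_big_seq (fun j => iter (d j) (op (X j)) z)).
    exact: opA.
  by move=> j je; rewrite (negbTE (_ : j != i)) //; apply: contraNneq ie => <-.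
rewrite (negbTE (_ : i != p)); last by apply: contraNneq ie => ->.
apply: R_trans (equiv_opCA _ _ _) _; apply: op_cong (R_refl _) _.
exact: IH.
Qed.

End BigUpToEquivalence.

Section Isomorphism.
Variables (F : fieldType) (l : nat).

Lemma bij_lfunP (U V : vectType F) (f : 'Hom(U, V)) :
  bijective f -> cancel f f^-1%VF /\ cancel f^-1%VF f.
Proof.
move=> bf; have fK : cancel f f^-1%VF.
  by apply: lker0_lfunK; apply/lker0P/bij_inj.
by split=> //; apply/(bij_can_sym bf).
Qed.

Lemma pmhomE (V W : pmod F l) (g : forall k, 'Hom(V k, W k)) i u :
  is_pmhom g -> g (tgt i) (pm_map V i u) = pm_map W i (g (src i) u).
Proof. by move=> hg; rewrite -comp_lfunE hg comp_lfunE. Qed.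

Lemma pmhomP (V W : pmod F l) (g : forall k, 'Hom(V k, W k)) :
  (forall i u, g (tgt i) (pm_map V i u) = pm_map W i (g (src i) u)) ->
  is_pmhom g.
Proof. by move=> hg i; apply/lfunP => u; rewrite 2!comp_lfunE hg. Qed.

Lemma pmhom_id (V : pmod F l) : is_pmhom (fun k => \1%VF : 'Hom(V k, V k)).
Proof. by move=> i; rewrite comp_lfun1l comp_lfun1r. Qed.

Lemma pmhom_comp (V W X : pmod F l) (g : forall k, 'Hom(V k, W k))
  (h : forall k, 'Hom(W k, X k)) :
  is_pmhom g -> is_pmhom h -> is_pmhom (fun k => (h k \o g k)%VF).
Proof. by move=> hg hh i; rewrite -comp_lfunA hg comp_lfunA hh comp_lfunA. Qed.

Lemma pmhom_inv (V W : pmod F l) (g : forall k, 'Hom(V k, W k)) :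
  is_pmiso g -> is_pmhom (fun k => (g k)^-1%VF).
Proof.
move=> [hg bg] i; apply/lfunP => u; rewrite !comp_lfunE.
have [_ gK] := bij_lfunP (bg (src i)); have [gK' _] := bij_lfunP (bg (tgt i)).
by rewrite -{1}[u]gK -pmhomE // gK'.
Qed.

Lemma pmiso_id (V : pmod F l) : is_pmiso (fun k => \1%VF : 'Hom(V k, V k)).
Proof. by split; [apply: pmhom_id|move=> k; exists id => u; rewrite lfunE]. Qed.

Lemma pmiso_comp (V W X : pmod F l) (g : forall k, 'Hom(V k, W k))
  (h : forall k, 'Hom(W k, X k)) :
  is_pmiso g -> is_pmiso h -> is_pmiso (fun k => (h k \o g k)%VF).
Proof.
move=> [hg bg] [hh bh]; split; first exact: pmhom_comp.
move=> k; apply: eq_bij (bij_comp (bh k) (bg k)) _ _ => u.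
by rewrite comp_lfunE.
Qed.

Lemma pmiso_inv (V W : pmod F l) (g : forall k, 'Hom(V k, W k)) :
  is_pmiso g -> is_pmiso (fun k => (g k)^-1%VF).
Proof.
move=> ig; split; first exact: pmhom_inv.
by move=> k; have [gK Kg] := bij_lfunP (ig.2 k); exists (g k).
Qed.

Lemma pmiso_sum (V W V' W' : pmod F l) (g : forall k, 'Hom(V k, W k))
  (g' : forall k, 'Hom(V' k, W' k)) : is_pmiso g -> is_pmiso g' ->
  @is_pmiso F l (pm_oplus V V') (pm_oplus W W') (fun k => hom_sum (g k) (g' k)).
Proof.
move=> [hg bg] [hg' bg']; split=> [i|k].
  apply/lfunP => u; rewrite !comp_lfunE /= !hom_sumE /=.
  by rewrite -!comp_lfunE hg hg'.
have [[f gK Kg] [f' gK' Kg']] := (bg k, bg' k).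
exists (fun u => (f u.1, f' u.2)) => -[u u']; rewrite hom_sumE /= ?gK ?gK' //.
by rewrite Kg Kg'.
Qed.

Definition swap_lfun (U V : vectType F) : 'Hom((U * V)%type, (V * U)%type) :=
  lfun_of (fun (a : F) (u v : U * V) =>
    erefl : (fun u => (u.2, u.1)) (a *: u + v) = a *: (u.2, u.1) + (v.2, v.1)).

Definition assoc_lfun (U V W : vectType F) :
    'Hom((U * (V * W))%type, (U * V * W)%type) :=
  lfun_of (fun (a : F) (u v : U * (V * W)) =>
    erefl : (fun u => (u.1, u.2.1, u.2.2)) (a *: u + v)
      = a *: (u.1, u.2.1, u.2.2) + (v.1, v.2.1, v.2.2)).

Definition snd_lfun (U V : vectType F) : 'Hom((U * V)%type, V) :=
  lfun_of (fun (a : F) (u v : U * V) =>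
    erefl : snd (a *: u + v) = a *: u.2 + v.2).

Lemma swap_lfunE U V u : swap_lfun U V u = (u.2, u.1).
Proof. exact: lfun_ofE. Qed.

Lemma assoc_lfunE U V W u : assoc_lfun U V W u = (u.1, u.2.1, u.2.2).
Proof. exact: lfun_ofE. Qed.

Lemma snd_lfunE U V u : snd_lfun U V u = u.2.
Proof. exact: lfun_ofE. Qed.

Lemma pmiso_swap (V W : pmod F l) :
  @is_pmiso F l (pm_oplus V W) (pm_oplus W V) (fun k => swap_lfun (V k) (W k)).
Proof.
split=> [i|k].
  by apply/lfunP => u; rewrite !comp_lfunE /= !swap_lfunE !hom_sumE.
by exists (swap_lfun (W k) (V k)) => -[u v]; rewrite !swap_lfunE.
Qed.

Lemma pmiso_assoc (V W X : pmod F l) :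
  @is_pmiso F l (pm_oplus V (pm_oplus W X)) (pm_oplus (pm_oplus V W) X)
    (fun k => assoc_lfun (V k) (W k) (X k)).
Proof.
split=> [i|k].
  apply/lfunP => u; rewrite !comp_lfunE /= !assoc_lfunE /=.
  by do 3?[rewrite !hom_sumE /=].
exists (fun u => (u.1.1, (u.1.2, u.2))) => [[u [v w]]|[[u v] w]];
  by rewrite assoc_lfunE.
Qed.

Lemma pmiso_snd (V : pmod F l) :
  @is_pmiso F l (pm_oplus (pm_zero F l) V) V (fun k => snd_lfun 'rV[F]_0 (V k)).
Proof.
split=> [i|k].
  by apply/lfunP => u; rewrite !comp_lfunE /= !snd_lfunE /= !hom_sumE /=.
exists (pair 0) => [[u v]|v]; rewrite snd_lfunE //=.
by rewrite [u]thinmx0.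
Qed.

Lemma pm_iso_refl V : @pm_iso F l V V.
Proof. by eexists; apply: pmiso_id. Qed.

Lemma pm_iso_sym V W : @pm_iso F l V W -> pm_iso W V.
Proof. by move=> [g ig]; eexists; apply: pmiso_inv ig. Qed.

Lemma pm_iso_trans W V X : @pm_iso F l V W -> pm_iso W X -> pm_iso V X.
Proof. by move=> [g ig] [h ih]; eexists; apply: pmiso_comp ig ih. Qed.

Lemma pm_iso_oplus V V' W W' : @pm_iso F l V V' -> @pm_iso F l W W' ->
  pm_iso (pm_oplus V W) (pm_oplus V' W').
Proof. by move=> [g ig] [h ih]; eexists; apply: pmiso_sum ig ih. Qed.

Lemma pm_iso_oplusC V W : @pm_iso F l (pm_oplus V W) (pm_oplus W V).
Proof. by eexists; apply: pmiso_swap. Qed.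

Lemma pm_iso_oplusA V W X :
  @pm_iso F l (pm_oplus V (pm_oplus W X)) (pm_oplus (pm_oplus V W) X).
Proof. by eexists; apply: pmiso_assoc. Qed.

Lemma pm_iso_oplus0 V : @pm_iso F l (pm_oplus (pm_zero F l) V) V.
Proof. by eexists; apply: pmiso_snd. Qed.

Lemma pm_iso_retract V W : @pm_iso F l V W -> pm_retract V W.
Proof.
move=> [g ig]; exists (fun k => (g k)^-1%VF), g; split; last first.
- by move=> k; apply/lfunP => u; rewrite !lfunE /= (bij_lfunP (ig.2 k)).2.
- by case: ig.
exact: pmhom_inv.
Qed.

Lemma ladder_iso_refl L : @ladder_iso F l L L.
Proof.
do 2!eexists; split; [exact: pmiso_id|exact: pmiso_id|move=> k].
by rewrite comp_lfun1l comp_lfun1r.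
Qed.

Lemma ladder_iso_sym L M : @ladder_iso F l L M -> ladder_iso M L.
Proof.
move=> [g [h [ig ih gh]]].
do 2!eexists; split; [exact: pmiso_inv ig|exact: pmiso_inv ih|move=> k].
have [_ gK] := bij_lfunP (ig.2 k); have [hK _] := bij_lfunP (ih.2 k).
apply/lfunP => u; rewrite !comp_lfunE -{1}[u]gK.
by rewrite -(comp_lfunE (lad_phi M k)) -gh comp_lfunE hK.
Qed.

Lemma ladder_iso_trans M L N :
  @ladder_iso F l L M -> ladder_iso M N -> ladder_iso L N.
Proof.
move=> [g [h [ig ih gh]]] [g' [h' [ig' ih' gh']]].
do 2!eexists; split; [exact: pmiso_comp ig ig'|exact: pmiso_comp ih ih'|].
move=> k.
by rewrite -comp_lfunA gh comp_lfunA gh' comp_lfunA.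
Qed.

Lemma ladder_iso_oplus L L' M M' :
  @ladder_iso F l L L' -> @ladder_iso F l M M' ->
  ladder_iso (ladder_oplus L M) (ladder_oplus L' M').
Proof.
move=> [g [h [ig ih gh]]] [g' [h' [ig' ih' gh']]].
do 2!eexists; split; [exact: pmiso_sum ig ig'|exact: pmiso_sum ih ih'|move=> k].
by apply/lfunP => u; rewrite !comp_lfunE /= !hom_sumE /= -!comp_lfunE gh gh'.
Qed.

Lemma ladder_iso_oplusC L M :
  @ladder_iso F l (ladder_oplus L M) (ladder_oplus M L).
Proof.
do 2!eexists; split; [exact: pmiso_swap|exact: pmiso_swap|move=> k].
by apply/lfunP => u; rewrite !comp_lfunE /= !swap_lfunE !hom_sumE.
Qed.

Lemma ladder_iso_oplusA L M N : @ladder_iso F l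
  (ladder_oplus L (ladder_oplus M N)) (ladder_oplus (ladder_oplus L M) N).
Proof.
do 2!eexists; split; [exact: pmiso_assoc|exact: pmiso_assoc|move=> k].
apply/lfunP => u; rewrite !comp_lfunE /= !assoc_lfunE /=.
by do 3?[rewrite !hom_sumE /=].
Qed.

Lemma ladder_iso_oplus0 L :
  @ladder_iso F l (ladder_oplus (ladder_zero F l) L) L.
Proof.
do 2!eexists; split; [exact: pmiso_snd|exact: pmiso_snd|move=> k].
by apply/lfunP => u; rewrite !comp_lfunE /= !snd_lfunE /= !hom_sumE /=.
Qed.

End Isomorphism.

(** * Split summands *)

Section Splitting.
Variables (F : fieldType) (l : nat).

Definition pm_size (V : pmod F l) : nat := \sum_k \dim {:V k}.

Definition pair_lfun (U V W : vectType F) (f : 'Hom(U, V)) (g : 'Hom(U, W)) :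
    'Hom(U, (V * W)%type) :=
  lfun_of (fun (a : F) (u v : U) =>
    f_equal2 pair (linearP f a u v) (linearP g a u v)
      : (fun u => (f u, g u)) (a *: u + v) = a *: (f u, g u) + (f v, g v)).

Lemma pair_lfunE (U V W : vectType F) (f : 'Hom(U, V)) (g : 'Hom(U, W)) u :
  pair_lfun f g u = (f u, g u).
Proof. exact: lfun_ofE. Qed.

Section Complement.
Variables (V A : pmod F l) (s : forall k, 'Hom(A k, V k)).
Variable r : forall k, 'Hom(V k, A k).
Hypotheses (hs : is_pmhom s) (hr : is_pmhom r).
Hypothesis rs : forall k, (r k \o s k)%VF = \1%VF.

Definition compl_in k : 'Hom(subvs_of (lker (r k)), V k) := linfun vsval.

Definition compl_proj k : 'Hom(V k, subvs_of (lker (r k))) :=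
  (linfun (vsproj (lker (r k))) \o (\1 - (s k \o r k)))%VF.

(** The kernel of [r], stable under the structure maps once [r] is a morphism; [compl_proj] is the
    projection [1 - s r] with codomain restricted to this kernel. *)
Definition pm_compl : pmod F l :=
  @PMod F l (fun k => subvs_of (lker (r k)))
    (fun i => compl_proj (tgt i) \o (pm_map V i \o compl_in (src i)))%VF.

Lemma retractK k u : r k (s k u) = u.
Proof. by rewrite -comp_lfunE rs lfunE. Qed.

Lemma compl_inE k u : compl_in k u = vsval u.
Proof. exact: lfunE. Qed.

Lemma compl_projE k v : vsval (compl_proj k v) = v - s k (r k v).
Proof.
have E : (\1 - (s k \o r k))%VF v = v - s k (r k v).
  by rewrite add_lfunE opp_lfunE id_lfunE comp_lfunE.
rewrite comp_lfunE E lfunE /= vsprojK // memv_ker linearB /= retractK.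
by rewrite subrr.
Qed.

Lemma retract_compl k u : r k (compl_in k u) = 0.
Proof. by rewrite compl_inE; apply/eqP; rewrite -memv_ker subvsP. Qed.

Lemma compl_inK k u : compl_proj k (compl_in k u) = u.
Proof.
by apply: val_inj; rewrite /= compl_projE retract_compl linear0 subr0 compl_inE.
Qed.

Lemma compl_proj_sec k u : compl_proj k (s k u) = 0.
Proof. by apply: val_inj; rewrite /= compl_projE retractK subrr. Qed.

Lemma compl_add k v : s k (r k v) + compl_in k (compl_proj k v) = v.
Proof. by rewrite compl_inE compl_projE addrC subrK. Qed.

Lemma pm_complE i u : pm_map pm_compl i u =
  compl_proj (tgt i) (pm_map V i (compl_in (src i) u)).
Proof.
by rewrite [LHS]comp_lfunE; congr (compl_proj _ _); rewrite comp_lfunE.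
Qed.

Lemma pmhom_compl_proj : @is_pmhom F l V pm_compl compl_proj.
Proof.
apply: pmhomP => i v; rewrite pm_complE.
rewrite -{1}[v]compl_add !linearD /= -(pmhomE _ hs).
by rewrite compl_proj_sec add0r.
Qed.

Lemma pmhom_compl_in : @is_pmhom F l pm_compl V compl_in.
Proof.
apply: pmhomP => i u; rewrite pm_complE -[RHS]compl_add.
by rewrite pmhomE // retract_compl !linear0 add0r.
Qed.

Lemma compl_retract : pm_retract V pm_compl.
Proof.
exists compl_in, compl_proj.
split; [exact: pmhom_compl_in|exact: pmhom_compl_proj|].
by move=> k; apply/lfunP => u; rewrite !lfunE /= compl_inK.
Qed.

Lemma pmiso_compl :
  @is_pmiso F l V (pm_oplus A pm_compl)
    (fun k => pair_lfun (r k) (compl_proj k)).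
Proof.
split=> [|k].
  apply: pmhomP => i u; rewrite !pair_lfunE /= hom_sumE /= pmhomE //.
  by rewrite -(pmhomE _ pmhom_compl_proj).
exists (fun u => s k u.1 + compl_in k u.2) => [v|[u w]]; rewrite pair_lfunE /=.
  exact: compl_add.
rewrite !linearD /= retractK retract_compl compl_proj_sec compl_inK.
by rewrite addr0 add0r.
Qed.

Lemma pm_size_compl : (pm_size pm_compl + pm_size A <= pm_size V)%N.
Proof.
rewrite /pm_size -big_split /=; apply: leq_sum => k _.
(* Rank-nullity for [r k], which is onto because [s k] is a section of it. *)
rewrite -(limg_ker_dim (r k) fullv) capfv !dimvf leq_add2l -dimvf.
apply/dimvS/subvP => u _; rewrite -[u](retractK (k := k)).
exact: memv_img (memvf _).
Qed.

End Complement.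

(** The two compatibility conditions kill the two off-diagonal blocks of [phi], so [phi] is the sum
    of its restrictions to [A] and to the kernels of the retractions. *)
Lemma ladder_split (L A : ladder F l)
  (sV : forall k, 'Hom(lad_V A k, lad_V L k))
  (rV : forall k, 'Hom(lad_V L k, lad_V A k))
  (sW : forall k, 'Hom(lad_W A k, lad_W L k))
  (rW : forall k, 'Hom(lad_W L k, lad_W A k)) :
  is_pmhom sV -> is_pmhom rV -> is_pmhom sW -> is_pmhom rW ->
  (forall k, (rV k \o sV k)%VF = \1%VF) ->
  (forall k, (rW k \o sW k)%VF = \1%VF) ->
  (forall k u, lad_phi L k (sV k u) = sW k (lad_phi A k u)) ->
  (forall k u, rW k (lad_phi L k u) = lad_phi A k (rV k u)) ->
  exists K : ladder F l, [/\ ladder_iso L (ladder_oplus A K),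
    pm_retract (lad_V L) (lad_V K), pm_retract (lad_W L) (lad_W K),
    (pm_size (lad_V K) + pm_size (lad_V A) <= pm_size (lad_V L))%N &
    (pm_size (lad_W K) + pm_size (lad_W A) <= pm_size (lad_W L))%N].
Proof.
move=> hsV hrV hsW hrW rsV rsW phis phir.
have hphi : @is_pmhom F l (pm_compl sV rV) (pm_compl sW rW)
    (fun k => (compl_proj sW rW k \o lad_phi L k) \o compl_in rV k)%VF.
  apply: pmhom_comp (pmhom_comp (lad_phiP L) _); first exact: pmhom_compl_in.
  exact: pmhom_compl_proj.
exists (Ladder hphi); split; last 2 first.
- exact: pm_size_compl.
- exact: pm_size_compl.
- do 2!eexists; split; [exact: pmiso_compl|exact: pmiso_compl|move=> k].
  apply/lfunP => v; rewrite 2!comp_lfunE !pair_lfunE /= hom_sumE /= phir.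
  congr pair; rewrite [RHS]comp_lfunE [RHS]comp_lfunE.
  rewrite -{1}[v](compl_add rsV) !linearD /= phis.
  by rewrite (compl_proj_sec rsW) add0r.
- exact: compl_retract.
- exact: compl_retract.
Qed.

End Splitting.

(** * Splitting off a bar *)

Section Bars.
Variables (F : fieldType) (l : nat).

(** For [m] a boolean, [row_sum] and [const_mx] identify ['rV_m] with [F] or 0, treating positions
    inside and outside a bar alike. *)
Definition row_sum m (u : 'rV[F]_m) : F := \sum_j u 0 j.

Lemma row_sum_linear m : linear (@row_sum m : 'rV[F]_m -> F^o).
Proof.
move=> a u v; rewrite /row_sum scaler_sumr -big_split.
by apply: eq_bigr => j _; rewrite !mxE.
Qed.

Lemma row_sum_scale_linear m (V : vectType F) (x : V) :
  linear (fun u : 'rV[F]_m => row_sum u *: x).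
Proof. by move=> a u v; rewrite row_sum_linear scalerDl -scalerA. Qed.

Lemma row_sum_const (m : bool) c : row_sum (const_mx c : 'rV_m) = c *+ m.
Proof. by rewrite /row_sum; case: m; rewrite ?big_ord0 // big_ord1 mxE. Qed.

Lemma const_row_sum (m : bool) (u : 'rV[F]_m) : const_mx (row_sum u) = u.
Proof.
apply/rowP => j; rewrite mxE /row_sum; case: m u j => [|] u; last by case.
by move=> j; rewrite big_ord1 !ord1.
Qed.

Lemma id_or_0_bool (m n : bool) (u : 'rV[F]_m) :
  id_or_0 F m n u = const_mx (row_sum u).
Proof.
rewrite id_or_0E; apply/rowP => j; rewrite !mxE /row_sum.
case: m u => [|] u; last by rewrite !big_ord0.
rewrite !big_ord1 mxE; case: n j => [|] [] // [] //= _.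
by rewrite mulr1.
Qed.

Definition bar_in (b : pinterval l) (V : pmod F l) (x : forall k, V k) k :
    'Hom(interval_pmod F b k, V k) :=
  lfun_of (@row_sum_scale_linear (in_interval b k) (V k) (x k)).

Lemma const_mx_linear m n : linear (@const_mx F m n : F^o -> 'M_(m, n)).
Proof. by move=> a u v; apply/matrixP => i j; rewrite !mxE. Qed.

Definition bar_out (b : pinterval l) (V : pmod F l)
    (xi : forall k, 'Hom(V k, F^o)) k : 'Hom(V k, interval_pmod F b k) :=
  (lfun_of (@const_mx_linear 1 (in_interval b k)) \o xi k)%VF.

Lemma bar_inE b V x k u : @bar_in b V x k u = row_sum u *: x k.
Proof. exact: lfun_ofE. Qed.

Lemma bar_outE b V xi k v : @bar_out b V xi k v = const_mx (xi k v).
Proof. by rewrite comp_lfunE lfun_ofE. Qed.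

(** Outside [b] the source is 0, so only steps starting in [b] impose a condition; the [else] branch
    is the death of the bar. *)
Lemma pmhom_bar_in b (V : pmod F l) (x : forall k, V k) :
  (forall i, in_interval b (src i) ->
     pm_map V i (x (src i)) = if in_interval b (tgt i) then x (tgt i) else 0) ->
  is_pmhom (@bar_in b V x).
Proof.
move=> hx; apply: pmhomP => i u; rewrite !bar_inE linearZ /= id_or_0_bool.
rewrite row_sum_const; move: (hx i) (u : 'rV_(in_interval b (src i))) => {hx u}.
case: (in_interval b (src i)) => [/(_ isT)-> u|_ u]; last first.
  by rewrite /row_sum big_ord0 mul0rn !scale0r.
by case: ifP; rewrite ?scaler0 ?scale0r.
Qed.

(** Dual to [pmhom_bar_in]: the [else] branch is the birth of the bar, where the functional must
    kill all that comes from before. *)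
Lemma pmhom_bar_out b (V : pmod F l) (xi : forall k, 'Hom(V k, F^o)) :
  (forall i v, in_interval b (tgt i) ->
     xi (tgt i) (pm_map V i v)
       = if in_interval b (src i) then xi (src i) v else 0) ->
  is_pmhom (@bar_out b V xi).
Proof.
move=> hx; apply: pmhomP => i v.
rewrite !bar_outE /= id_or_0_bool row_sum_const.
move: (hx i v) => {hx}; case: (in_interval b (tgt i)) => [/(_ isT)->|_].
  by case: ifP.
by apply/rowP; case.
Qed.

Lemma bar_inK b (V : pmod F l) (x : forall k, V k)
    (xi : forall k, 'Hom(V k, F^o)) :
  (forall k, in_interval b k -> xi k (x k) = 1) ->
  forall k, (@bar_out b V xi k \o @bar_in b V x k)%VF = \1%VF.
Proof.
move=> hx k; apply/lfunP => u.
rewrite comp_lfunE bar_inE bar_outE id_lfunE linearZ /=.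
move: (hx k) (u : 'rV_(in_interval b k)) => {hx u}.
case: (in_interval b k) => [hk u|_ u].
  rewrite hk // -[RHS]const_row_sum; congr const_mx; exact: mulr1.
by apply/rowP; case.
Qed.

(** The projection [1 - projv U] kills [U] but not [x]; a coordinate that is nonzero on its value at
    [x], rescaled, is the functional. *)
Lemma exists_functional (V : vectType F) (U : {vspace V}) x : x \notin U ->
  exists xi : 'Hom(V, F^o), xi x = 1 /\ forall u, u \in U -> xi u = 0.
Proof.
move=> xU; pose p := (\1 - projv U)%VF.
have pE u : p u = u - projv U u by rewrite /p add_lfunE opp_lfunE id_lfunE.
have px : p x != 0.
  by rewrite pE subr_eq0; apply: contraNneq xU => ->; apply: memv_proj.
pose c j : V -> F^o := coord (vbasis fullv) j.
have [j pj] : exists j, c j (p x) != 0.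
  apply/existsP; apply: contraNT px; rewrite negb_exists => /forallP c0.
  rewrite [p x](coord_vbasis (memvf _)) big1 // => j _.
  by have := negbNE (c0 j); rewrite /c => /eqP ->; rewrite scale0r.
have lin : linear (fun u => (c j (p x))^-1 * c j (p u) : F^o).
  move=> a u v; rewrite /c !linearP /= mulrDr; congr (_ + _).
  by rewrite mulrCA.
exists (lfun_of lin); rewrite lfun_ofE mulVf //; split=> // u uU.
have pu : p u = 0 by rewrite pE projv_id // subrr.
by rewrite lfun_ofE pu /c linear0 mulr0.
Qed.

Definition bar (a j : 'I_l.+1) (aj : (a <= j)%N) : pinterval l := Sub (a, j) aj.

Lemma in_bar (a j : 'I_l.+1) (aj : (a <= j)%N) k :
  in_interval (bar aj) k = (a <= k <= j)%N.
Proof. by []. Qed.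

(** The data of a split summand on [[a, j]]: a generator dead after [j] and a functional at [j]
    blind to classes older than [a]. *)
Definition is_bar (V : pmod F l) (a j : 'I_l.+1) (v : V a)
    (xi : 'Hom(V j, F^o)) :=
  [/\ forall k : 'I_l.+1, (j < k)%N -> trans V a k v = 0,
      forall (k : 'I_l.+1) u, (k < a)%N -> xi (trans V k j u) = 0 &
      xi (trans V a j v) = 1].

(** Pushing [v] forward to [k] and pulling [xi] back to [k] pair to the value of [xi] on the image
    of [v] at [j], which is 1, at every [k] of the bar. *)
Lemma is_bar_hom (V : pmod F l) (a j : 'I_l.+1) (v : V a) xi (aj : (a <= j)%N) :
  is_bar v xi ->
  [/\ is_pmhom (bar_in (bar aj) (fun k => trans V a k v)),
      is_pmhom (bar_out (bar aj) (fun k => xi \o trans V k j)%VF) &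
      forall k, (bar_out (bar aj) (fun k => xi \o trans V k j)%VF k \o
        bar_in (bar aj) (fun k => trans V a k v) k)%VF = \1%VF].
Proof.
move=> [vj xia xiv]; split.
- apply: pmhom_bar_in => i; rewrite in_bar => /andP[] ai ij.
  rewrite -(comp_lfunE (pm_map V i)) -trans_tgt //; case: ifP => // /negbT.
  rewrite in_bar negb_and -!ltnNge.
  case/orP => [|/vj //]; rewrite tgt_val ltnNge => /negP[].
  exact: leq_trans ai (leqnSn _).
- apply: pmhom_bar_out => i u; rewrite in_bar => /andP[] ai ij.
  rewrite !comp_lfunE -trans_src //; case: ifP => // /negbT.
  rewrite in_bar negb_and -!ltnNge.
  case/orP => [/xia //|]; rewrite ltnNge => /negP[].
  by apply: leq_trans ij; rewrite tgt_val.
- apply: bar_inK => k; rewrite in_bar => /andP[] ak kj.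
  by rewrite comp_lfunE trans_comp.
Qed.

Lemma pm_size_interval (b : pinterval l) : (0 < pm_size (interval_pmod F b))%N.
Proof.
rewrite /pm_size (bigD1 (val b).1) //= dimvf /dim /= mul1n.
by rewrite /in_interval /lo leqnn /= (valP b).
Qed.

End Bars.

(** * Bars of earliest birth and bars through a given class *)

Section FirstBar.
Variables (F : fieldType) (l : nat).
Implicit Types V W : pmod F l.

Lemma fullv_eq0 (U : vectType F) : {:U}%VS = 0%VS -> forall u : U, u = 0.
Proof. by move=> U0 u; apply/eqP; rewrite -memv0 -U0 memvf. Qed.

Lemma earliest_bar V : (exists k, {:V k}%VS != 0%VS) ->
  exists (a j : 'I_l.+1) (v : V a), [/\ (a <= j)%N,
    forall k : 'I_l.+1, (k < a)%N -> {:V k}%VS = 0%VS,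
    lker (trans V a j) == 0%VS, v != 0 &
    forall k : 'I_l.+1, (j < k)%N -> trans V a k v = 0].
Proof.
move=> [k0 k0P].
case: (@arg_minnP _ k0 (fun k => {:V k}%VS != 0%VS)
  (fun k : 'I_l.+1 => k : nat) k0P) => a aP amin.
(* The [j] sought is the last position into which [V_a] injects. *)
pose P (j : 'I_l.+1) := (a <= j)%N && (lker (trans V a j) == 0%VS).
have Pa : P a by rewrite /P leqnn trans_id; apply/lker0P => u v; rewrite !lfunE.
case: (arg_maxnP (fun k : 'I_l.+1 => k : nat) Pa) => j /andP[aj inj] jmax.
have [v [v0 vj]] : exists v : V a, v != 0 /\
    forall k : 'I_l.+1, (j < k)%N -> trans V a k v = 0.
  case: (ord_max_or_src j) => [jm|[i ji]].
    exists (vpick {:V a}%VS); rewrite vpick0; split=> // k.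
    rewrite jm /= ltnNge.
    by rewrite -ltnS ltn_ord.
  (* Here [tgt i] is [j + 1]; by maximality of [j] the kernel of the map to it is nonzero, and [v]
     is picked there. *)
  have ai : (a <= tgt i)%N by rewrite tgt_val (leq_trans aj) // ji /= leqnSn.
  exists (vpick (lker (trans V a (tgt i)))); rewrite vpick0; split.
    apply: contraT => /negbNE ki0; have := jmax (tgt i).
    by rewrite /P ai ki0 ji tgt_val /= ltnn => /(_ isT).
  move=> k jk; have ik : (tgt i <= k)%N by rewrite tgt_val; rewrite ji in jk.
  have := memv_pick (lker (trans V a (tgt i))); rewrite memv_ker => /eqP v0.
  by rewrite -(trans_comp _ ai ik) v0 linear0.
exists a, j, v; split=> // k; apply: contraTeq => /amin.
by rewrite -leqNgt.
Qed.

(** Induction on [k]: as [v] survives to [j], a class at [k + 1] that dies at [j] comes from a class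
    at [k], which dies at [j] too and so is 0. *)
Lemma unnested_inj V (a j : 'I_l.+1) (v : V a) : unnested V ->
  lker (trans V a j) == 0%VS -> v != 0 ->
  forall k : 'I_l.+1, (a <= k)%N -> (k <= j)%N -> lker (trans V k j) == 0%VS.
Proof.
move=> nV inj v0; apply: ord_tgt_ind => // i ai IH ij.
have sj : (src i <= j)%N by apply: leq_trans ij; rewrite tgt_val.
have {IH} inj_i := IH sj.
have tr0 : trans V (src i) j != 0.
  apply: contraNneq v0 => tr0; rewrite -(inj_eq (lker0P inj)) linear0.
  by rewrite -(trans_comp _ ai sj) tr0 lfunE.
rewrite -subv0; apply/subvP => u uk.
have /memv_imgP[u' _ uu'] := subvP (nV i j ij tr0) u uk.
move: uk; rewrite memv_ker uu' -trans_src // -(linear0 (trans V (src i) j)).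
by rewrite (inj_eq (lker0P inj_i)) => /eqP ->; rewrite linear0 mem0v.
Qed.

(* The bar of w runs from the first position where w has a preimage y to the  *)
(* death of w. If y merged with an older class before dying, their difference *)
(* would by unnestedness also be older, and w would have an earlier preimage. *)
Lemma bar_through W (a : 'I_l.+1) (w : W a) : unnested W -> w != 0 ->
  exists (i j : 'I_l.+1) (y : W i) (xi : 'Hom(W j, F^o)),
    [/\ (i <= a)%N, (a <= j)%N, is_bar y xi, trans W i a y = w
      & trans W a j w != 0].
Proof.
move=> nW w0.
pose P (j : 'I_l.+1) := (a <= j)%N && (trans W a j w != 0).
have Pa : P a by rewrite /P leqnn trans_id lfunE.
case: (arg_maxnP (fun k : 'I_l.+1 => k : nat) Pa) => j /andP[aj wj] jmax.
pose Q (i : 'I_l.+1) := (i <= a)%N && (w \in limg (trans W i a)).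
have Qa : Q a.
  by rewrite /Q leqnn trans_id -[X in X \in _]id_lfunE memv_img ?memvf.
case: (arg_minnP (fun k : 'I_l.+1 => k : nat) Qa).
move=> i /andP[ia /memv_imgP[y _ yw]] imin.
have ij := leq_trans ia aj.
(* [U] contains all classes at [j] born before [i]: it is 0 if [i] is the first position, and the
   image of position [i - 1] otherwise. *)
have [U yU Umax] : exists2 U : {vspace W j}, trans W i j y \notin U &
    forall (k : 'I_l.+1) u, (k < i)%N -> trans W k j u \in U.
  case: (ord0_or_tgt i) => [i0|[i' ei]].
    exists 0%VS => [|k u]; last by rewrite i0.
    by rewrite memv0 -(trans_comp _ ia aj) -yw.
  move: y yw ia ij imin; rewrite {}ei => y yw ia ij imin.
  exists (limg (trans W (src i') j)); last first.
    move=> k u ki; rewrite -(trans_comp u (ki : (k <= src i')%N)); last first.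
      by apply: leq_trans ij; rewrite tgt_val.
    exact: memv_img (memvf _).
  apply/negP => /memv_imgP[y' _ yy'].
  have tr0 : trans W (src i') j != 0.
    apply: contraNneq wj => tr0.
    by rewrite yw trans_comp // yy' tr0 lfunE.
  have : y - pm_map W i' y' \in lker (trans W (tgt i') j).
    by rewrite memv_ker linearB /= -trans_src // yy' subrr.
  move=> /(subvP (nW i' j ij tr0))/memv_imgP[y'' _ ey].
  have /imin : Q (src i').
    rewrite /Q (leq_trans _ ia) ?tgt_val //=; apply/memv_imgP.
    exists (y'' + y'); rewrite ?memvf // trans_src // linearD /= -ey subrK.
    exact: yw.
  by rewrite tgt_val ltnn.
have [xi [xiy xiU]] := exists_functional yU.
exists i, j, y, xi; split=> //; split=> // [k jk|k u ki]; last exact/xiU/Umax.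
have ak : (a <= k)%N by apply: leq_trans aj (ltnW jk).
rewrite -(trans_comp _ ia ak) -yw; apply: contraTeq jk => wk.
by rewrite -leqNgt; apply: jmax; rewrite /P ak wk.
Qed.

(** Nothing is older than an earliest bar, so any functional equal to 1 on the last nonzero image of
    its generator will do. *)
Lemma pm_split_bar V : (exists k, {:V k}%VS != 0%VS) ->
  exists (a j : 'I_l.+1) (v : V a) (xi : 'Hom(V j, F^o)),
    (a <= j)%N /\ is_bar v xi.
Proof.
move=> /earliest_bar[a [j [v [aj Va inj v0 vj]]]].
have [] := @exists_functional F _ 0%VS (trans V a j v).
  by rewrite memv0 -(linear0 (trans V a j)) (inj_eq (lker0P inj)).
move=> xi [xiv _]; exists a, j, v, xi; split=> //; split=> // k u /Va V0.
by rewrite (fullv_eq0 V0 u) !linear0.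
Qed.

End FirstBar.

(** * Interval decompositions and nested bars *)

Section Decomposition.
Variables (F : fieldType) (l : nat).
Implicit Types (V W : pmod F l) (L : ladder F l) (b : pinterval l).

Lemma pmiso_zero V : (forall k, {:V k}%VS = 0%VS) ->
  @is_pmiso F l V (pm_zero F l) (fun=> 0).
Proof.
move=> V0; split=> [i|k]; first by rewrite comp_lfun0l comp_lfun0r.
exists (fun=> 0) => u; first by rewrite [u]fullv_eq0.
by rewrite lfunE [RHS]thinmx0.
Qed.

Lemma pm_big_incr (I : finType) (X : I -> pmod F l) d p : pm_iso
  (pm_oplus (X p) (\big[@pm_oplus F l/pm_zero F l]_(i : I) pm_pow (X i) (d i)))
  (\big[@pm_oplus F l/pm_zero F l]_(i : I) pm_pow (X i) ((i == p) + d i)).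
Proof.
apply: (@equiv_big_iterS _ _ _ (@pm_iso F l)).
- exact: pm_iso_refl.
- exact: pm_iso_sym.
- exact: pm_iso_trans.
- by move=> *; apply: pm_iso_oplus.
- exact: pm_iso_oplusC.
- exact: pm_iso_oplusA.
Qed.

(** The existence half of the structure theorem, by splitting off an earliest bar and inducting on
    total dimension. *)
Lemma pm_decomp V : exists d, is_bar_decomp V d.
Proof.
have [n] := ubnP (pm_size V); elim: n V => // n IH V ltVn.
have [/existsP V0|] := boolP [exists k, {:V k}%VS != 0%VS]; last first.
  rewrite negb_exists => /forallP V0; exists (fun=> 0%N).
  rewrite /is_bar_decomp.
  have iV := pmiso_zero (fun k => eqP (negbNE (V0 k))).
  apply: (@pm_iso_trans _ _ (pm_zero F l)); first by eexists; apply: iV.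
  apply: pm_iso_sym; apply: (@equiv_big_iter0 _ _ _ (@pm_iso F l)).
  - exact: pm_iso_refl.
  - exact: pm_iso_trans.
  - exact: pm_iso_oplus0.
have [a [j [v [xi [aj /(is_bar_hom aj)[hs hr rs]]]]]] := pm_split_bar V0.
have [|d dP] := IH (pm_compl (bar_in (bar aj) (fun k => trans V a k v))
    (bar_out (bar aj) (fun k => xi \o trans V k j)%VF)).
  rewrite ltnS in ltVn; apply: leq_trans (leq_trans (pm_size_compl rs) ltVn).
  by rewrite -addn1 leq_add2l pm_size_interval.
exists (fun b => (b == bar aj) + d b)%N.
apply: pm_iso_trans (pm_big_incr _ _ _).
apply: pm_iso_trans (pm_iso_oplus (pm_iso_refl _) dP).
by eexists; apply: pmiso_compl.
Qed.

(** Keeps [0 < d b] at the leaves, which is what places [b] in the barcode. *)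
Lemma big_pow_ind (P : pmod F l -> Prop) (d : pinterval l -> nat) :
  P (pm_zero F l) -> (forall V W, P V -> P W -> P (pm_oplus V W)) ->
  (forall b, (0 < d b)%N -> P (interval_pmod F b)) ->
  P (\big[@pm_oplus F l/pm_zero F l]_(b : pinterval l)
       pm_pow (interval_pmod F b) (d b)).
Proof.
move=> P0 PS PI; apply: big_ind => // b _; move: (PI b); rewrite /pm_pow.
case: (d b) => // n /(_ isT) Pb; elim: n => [|n IH]; first exact: PS.
exact: PS.
Qed.

Lemma row_sum0 (m : bool) (u : 'rV[F]_m) : ~~ m -> row_sum u = 0.
Proof. by case: m u => // u _; rewrite /row_sum big_ord0. Qed.

Lemma row_sum_inj (m : bool) : injective (@row_sum F m).
Proof. by move=> u v uv; rewrite -[u]const_row_sum uv const_row_sum. Qed.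

Lemma row_sum_const1 (m : bool) c : m -> row_sum (const_mx c : 'rV[F]_m) = c.
Proof. by move=> mT; rewrite row_sum_const mT. Qed.

Lemma row_sum_interval b i u : in_interval b (tgt i) ->
  row_sum (pm_map (interval_pmod F b) i u) = row_sum u.
Proof. by move=> bi; rewrite /= id_or_0_bool row_sum_const1. Qed.

Lemma row_sum_trans b (i j : 'I_l.+1) u :
  (i <= j)%N -> in_interval b i -> in_interval b j ->
  row_sum (trans (interval_pmod F b) i j u) = row_sum u.
Proof.
move: j; apply: ord_tgt_ind => [|i' ii' IH bi bi'].
  by rewrite trans_id lfunE.
rewrite trans_tgt // comp_lfunE row_sum_interval // IH //.
case/andP: bi bi' => bi _ /andP[_ bi']; apply/andP; split.
  exact: leq_trans bi ii'.
by apply: leq_trans bi'; rewrite tgt_val.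
Qed.

Lemma interval_trans_eq0 b (i j : 'I_l.+1) :
  ~~ ((lo b <= i) && (j <= hi b))%N -> trans (interval_pmod F b) i j = 0.
Proof.
move=> bij; case: (leqP i j) => [ij|/trans_gt-> //]; apply/lfunP => u.
rewrite lfunE; apply: (@row_sum_inj (in_interval b j)).
have [bi|/row_sum0 u0] := boolP (in_interval b i); last first.
  by rewrite (_ : u = 0) ?linear0 //; apply: row_sum_inj; rewrite u0 u0.
suff bj : ~~ in_interval b j by rewrite !row_sum0.
by apply: contra bij; case/andP: bi => -> _ /andP[].
Qed.

(** The only obstruction is a bar born exactly at [tgt i] and dead before [j]: a bar alive at
    [src i] maps onto position [tgt i], and one alive at both [tgt i] and [j] has zero kernel. *)
Lemma interval_lker_limg b (i : 'I_l) (j : 'I_l.+1) : (tgt i <= j)%N ->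
  ~~ ((lo b == tgt i :> nat) && (hi b < j)%N) ->
  (lker (trans (interval_pmod F b) (tgt i) j) <=
     limg (pm_map (interval_pmod F b) i))%VS.
Proof.
move=> ij bij; apply/subvP => u; rewrite memv_ker => /eqP uj.
have [bi|/row_sum0 u0] := boolP (in_interval b (tgt i)); last first.
  by rewrite (_ : u = 0) ?mem0v //; apply: row_sum_inj; rewrite u0 u0.
have [bi'|bi'] := boolP (in_interval b (src i)).
  apply/memv_imgP; exists (const_mx (row_sum u)); rewrite ?memvf //.
  by apply: row_sum_inj; rewrite row_sum_interval // row_sum_const1.
have bj : in_interval b j.
  case/andP: (bi) => bi1 bi2; rewrite /in_interval (leq_trans bi1 ij) leqNgt.
  apply: contra bij => ->; rewrite andbT eqn_leq bi1 ltnNge.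
  apply: contra bi' => bi'; rewrite /in_interval bi'.
  by apply: leq_trans bi2; rewrite tgt_val.
rewrite (_ : u = 0) ?mem0v //; apply: row_sum_inj.
rewrite -(row_sum_trans _ ij bi bj) uj.
by rewrite -(row_sum_trans 0 ij bi bj) linear0.
Qed.

Lemma no_nested_unnested V : no_strictly_nested_bars V -> unnested V.
Proof.
move=> nV i j ij tr0; have [d dP] := pm_decomp V.
have retr := pm_iso_retract (pm_iso_sym dP).
have bars b : (0 < d b)%N -> in_barcode V b by move=> db; exists d.
(* If no bar [c] spans [src i] and [j], the transition map vanishes on every summand, against [tr0];
   otherwise a bar obstructing the inclusion would be strictly nested in [c]. *)
have [/existsP[c /and3P[dc ci cj]]|] :=
    boolP [exists c, [&& (0 < d c)%N, (lo c <= src i)%N & (j <= hi c)%N]].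
  apply: (retract_lker_limg (i := i) (j := j) retr).
  apply: (big_pow_ind (P := fun U =>
    (lker (trans U (tgt i) j) <= limg (pm_map U i))%VS)) => [|V1 V2|b db].
  - by apply/subvP => u _; rewrite [u]thinmx0 mem0v.
  - exact: oplus_lker_limg.
  apply: interval_lker_limg => //.
  apply: contra (nV b c (bars b db) (bars c dc)) => /andP[/eqP lob hib].
  rewrite /strictly_nested lob tgt_val ltnS ci -tgt_val -lob (valP b).
  exact: leq_trans hib cj.
rewrite negb_exists => /forallP no_c; case/eqP: tr0.
apply: (retract_trans_eq0 retr).
apply: (big_pow_ind (P := fun U => trans U (src i) j = 0)) =>
  [|V1 V2 t1 t2|b db].
- by apply/lfunP => u; rewrite [LHS]thinmx0 [RHS]thinmx0.
- by apply/lfunP => u; rewrite trans_oplus t1 t2 !lfunE.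
by apply: interval_trans_eq0; have := no_c b; rewrite db.
Qed.

(** * Splitting one standard summand off a ladder *)

Definition splits_off L A := exists K : ladder F l,
  [/\ ladder_iso L (ladder_oplus A K),
      pm_retract (lad_V L) (lad_V K), pm_retract (lad_W L) (lad_W K),
      (pm_size (lad_V K) + pm_size (lad_V A) <= pm_size (lad_V L))%N &
      (pm_size (lad_W K) + pm_size (lad_W A) <= pm_size (lad_W L))%N].

Lemma split_minus L : (forall k, {:lad_V L k}%VS = 0%VS) ->
  (exists k, {:lad_W L k}%VS != 0%VS) ->
  exists b, splits_off L (ladder_minus F b).
Proof.
move=> V0 /pm_split_bar[a [j [w [xi [aj /(is_bar_hom aj)[hs hr rs]]]]]].
exists (bar aj); apply: (@ladder_split _ _ L (ladder_minus F (bar aj))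
  (fun=> 0) (fun=> 0) _ _ _ _ hs hr _ rs) => [||k|k u|k u].
- exact: zero_phiP.
- exact: zero_phiP.
- by apply/lfunP => u; rewrite [LHS]thinmx0 [RHS]thinmx0.
- by rewrite /= !zero_lfunE !linear0.
- by rewrite (fullv_eq0 (V0 k) u) !linear0.
Qed.

Lemma split_plus_or_R L : unnested (lad_V L) -> unnested (lad_W L) ->
  (exists k, {:lad_V L k}%VS != 0%VS) ->
  (exists b, splits_off L (ladder_plus F b)) \/
  (exists p, splits_off L (ladder_R F p)).
Proof.
move=> nV nW nzV; have [a [j [v [aj V0 inj v0 vj]]]] := earliest_bar nzV.
have V0u (k : 'I_l.+1) (u : lad_V L k) : (k < a)%N -> u = 0.
  by move=> /V0 /fullv_eq0.
have phi_trans k : lad_phi L k (trans (lad_V L) a k v)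
    = trans (lad_W L) a k (lad_phi L a v).
  by rewrite (trans_hom _ _ (lad_phiP L)).
case: (eqVneq (lad_phi L a v) 0) => [w0|w0].
  left; exists (bar aj).
  have [xi [xiv _]] : exists xi : 'Hom(lad_V L j, F^o),
      xi (trans (lad_V L) a j v) = 1 /\ forall u, u \in 0%VS -> xi u = 0.
    apply: exists_functional.
    by rewrite memv0 -(linear0 (trans (lad_V L) a j)) (inj_eq (lker0P inj)).
  have vb : is_bar v xi.
    by split=> // k u ka; rewrite (V0u k u ka) !linear0.
  have [hs hr rs] := is_bar_hom aj vb.
  apply: (@ladder_split _ _ L (ladder_plus F (bar aj))
    _ _ (fun=> 0) (fun=> 0) hs hr _ _ rs) => [||k|k u|k u].
  - exact: zero_phiP.
  - exact: zero_phiP.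
  - by apply/lfunP => u; rewrite [LHS]thinmx0 [RHS]thinmx0.
  - by rewrite bar_inE linearZ /= phi_trans w0 /= !zero_lfunE linear0 scaler0.
  - by rewrite /= !zero_lfunE.
right.
have [i1 [j1 [y [xi [ia aj1 yb yw wj1]]]]] := bar_through nW w0.
(* [phi v] cannot outlive [v]. *)
have j1j : (j1 <= j)%N.
  rewrite leqNgt; apply: contra wj1 => /vj tr0.
  by rewrite -phi_trans tr0 linear0.
have inj1 := unnested_inj nV inj v0 aj1 j1j.
(* The map from [V_j1] to [V_j] is injective, so its [^-1] is a left inverse and [eta] extends
   [xi o phi] from [V_j1] to [V_j]. *)
pose eta := ((xi \o lad_phi L j1) \o (trans (lad_V L) j1 j)^-1)%VF.
have etaE (k : 'I_l.+1) (u : lad_V L k) : (k <= j1)%N ->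
    eta (trans (lad_V L) k j u) = xi (trans (lad_W L) k j1 (lad_phi L k u)).
  move=> kj1; rewrite /eta 2!comp_lfunE -(trans_comp u kj1 j1j) lker0_lfunK //.
  by rewrite (trans_hom _ _ (lad_phiP L)).
have vb : is_bar v eta.
  split=> // [k u ka|]; first by rewrite (V0u k u ka) !linear0.
  by rewrite etaE // -yw trans_comp //; case: yb.
have bc : preceq (bar (leq_trans ia aj1)) (bar aj) by apply/and3P.
exists (Sub (bar (leq_trans ia aj1), bar aj) bc).
have [hs hr rs] := is_bar_hom aj vb.
have [hs' hr' rs'] := is_bar_hom (leq_trans ia aj1) yb.
apply: (@ladder_split _ _ L (ladder_R F (Sub (_, _) bc))
  _ _ _ _ hs hr hs' hr' rs rs') => k u.
  rewrite !bar_inE linearZ /= phi_trans id_or_0_bool row_sum_const.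
  case/orP: (orbN (in_interval (bar aj) k)) => [/andP[ak kj]|/row_sum0 u0];
    last first.
    by rewrite !u0 mul0rn !scale0r.
  move: (row_sum u) => c; rewrite -yw trans_comp // in_bar (leq_trans ia ak) /=.
  (* Past [j1] both sides vanish: the image of [y] is dead, and so is the lower bar of [R]. *)
  case: (leqP k j1) => // kj1.
  by have [yj _ _] := yb; rewrite yj // !scaler0.
rewrite !bar_outE /= id_or_0_bool row_sum_const.
apply/rowP => x; rewrite !mxE.
have : in_interval (bar (leq_trans ia aj1)) k.
  by move: x; case: (in_interval _ k) => // -[].
(* On [[i1, j1]], the part before [a] is harmless because [V] is 0 there; from [a] on, the equality
   is [etaE]. *)
rewrite in_bar in_bar => /andP[ik kj1]; case: (ltnP k a) => [ka|ak].
  by rewrite (V0u k u ka) !linear0.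
by rewrite (leq_trans kj1 j1j) /= mulr1n [LHS]comp_lfunE [RHS]comp_lfunE etaE.
Qed.

End Decomposition.

(** * Decomposition of ladders *)

Section LadderDecomposition.
Variables (F : fieldType) (l : nat).
Implicit Types (L A : ladder F l).

Lemma ladder_big_incr (I : finType) (X : I -> ladder F l) d p : ladder_iso
  (ladder_oplus (X p)
     (\big[@ladder_oplus F l/ladder_zero F l]_(i : I) ladder_pow (X i) (d i)))
  (\big[@ladder_oplus F l/ladder_zero F l]_(i : I)
     ladder_pow (X i) ((i == p) + d i)).
Proof.
apply: (@equiv_big_iterS _ _ _ (@ladder_iso F l)).
- exact: ladder_iso_refl.
- exact: ladder_iso_sym.
- exact: ladder_iso_trans.
- by move=> *; apply: ladder_iso_oplus.
- exact: ladder_iso_oplusC.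
- exact: ladder_iso_oplusA.
Qed.

Lemma ladder_big0 (I : finType) (X : I -> ladder F l) : ladder_iso
  (\big[@ladder_oplus F l/ladder_zero F l]_(i : I) ladder_pow (X i) 0)
  (ladder_zero F l).
Proof.
apply: (@equiv_big_iter0 _ _ _ (@ladder_iso F l)).
- exact: ladder_iso_refl.
- exact: ladder_iso_trans.
- exact: ladder_iso_oplus0.
Qed.

Lemma ladder_oplusCA (L M N : ladder F l) : ladder_iso
  (ladder_oplus L (ladder_oplus M N)) (ladder_oplus M (ladder_oplus L N)).
Proof.
apply: (@equiv_opCA _ _ (@ladder_iso F l)).
- exact: ladder_iso_refl.
- exact: ladder_iso_sym.
- exact: ladder_iso_trans.
- by move=> *; apply: ladder_iso_oplus.
- exact: ladder_iso_oplusC.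
- exact: ladder_iso_oplusA.
Qed.

Definition standard_ladder (r : preceq_pair l -> nat)
    (dplus dminus : pinterval l -> nat) : ladder F l :=
  ladder_oplus
    (ladder_oplus
      (\big[@ladder_oplus F l/ladder_zero F l]_(p : preceq_pair l)
         ladder_pow (ladder_R F p) (r p))
      (\big[@ladder_oplus F l/ladder_zero F l]_(b : pinterval l)
         ladder_pow (ladder_plus F b) (dplus b)))
    (\big[@ladder_oplus F l/ladder_zero F l]_(b : pinterval l)
       ladder_pow (ladder_minus F b) (dminus b)).

Definition decomposable L :=
  exists r dplus dminus, ladder_iso L (standard_ladder r dplus dminus).

Lemma decomposable_iso L M : ladder_iso L M -> decomposable M -> decomposable L.
Proof.
move=> LM [r [dp [dm MS]]]; exists r, dp, dm; exact: ladder_iso_trans LM MS.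
Qed.

Lemma decomposable_zero : decomposable (ladder_zero F l).
Proof.
exists (fun=> 0%N), (fun=> 0%N), (fun=> 0%N); apply: ladder_iso_sym.
apply: ladder_iso_trans (ladder_iso_oplus _ (ladder_big0 _)) _.
  2: exact: ladder_iso_oplus0.
exact: ladder_iso_trans (ladder_iso_oplus (ladder_big0 _) (ladder_big0 _))
  (ladder_iso_oplus0 _).
Qed.

Lemma decomposable_R p L :
  decomposable L -> decomposable (ladder_oplus (ladder_R F p) L).
Proof.
move=> [r [dp [dm LS]]]; exists (fun q => (q == p) + r q)%N, dp, dm.
apply: ladder_iso_trans (ladder_iso_oplus (ladder_iso_refl _) LS) _.
apply: ladder_iso_trans (ladder_iso_oplusA _ _ _) _.
apply: ladder_iso_oplus _ (ladder_iso_refl _).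
apply: ladder_iso_trans (ladder_iso_oplusA _ _ _) _.
exact: ladder_iso_oplus (ladder_big_incr _ _ _) (ladder_iso_refl _).
Qed.

Lemma decomposable_plus b L :
  decomposable L -> decomposable (ladder_oplus (ladder_plus F b) L).
Proof.
move=> [r [dp [dm LS]]]; exists r, (fun c => (c == b) + dp c)%N, dm.
apply: ladder_iso_trans (ladder_iso_oplus (ladder_iso_refl _) LS) _.
apply: ladder_iso_trans (ladder_iso_oplusA _ _ _) _.
apply: ladder_iso_oplus _ (ladder_iso_refl _).
apply: ladder_iso_trans (ladder_oplusCA _ _ _) _.
exact: ladder_iso_oplus (ladder_iso_refl _) (ladder_big_incr _ _ _).
Qed.

Lemma decomposable_minus b L :
  decomposable L -> decomposable (ladder_oplus (ladder_minus F b) L).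
Proof.
move=> [r [dp [dm LS]]]; exists r, dp, (fun c => (c == b) + dm c)%N.
apply: ladder_iso_trans (ladder_iso_oplus (ladder_iso_refl _) LS) _.
apply: ladder_iso_trans (ladder_oplusCA _ _ _) _.
exact: ladder_iso_oplus (ladder_iso_refl _) (ladder_big_incr _ _ _).
Qed.

Definition ladder_size L := (pm_size (lad_V L) + pm_size (lad_W L))%N.

Lemma unnested_decomposable L :
  unnested (lad_V L) -> unnested (lad_W L) -> decomposable L.
Proof.
have [n] := ubnP (ladder_size L); elim: n L => // n IH L ltLn nV nW.
(* Shared by the three kinds of summand: since [A] is nonzero the complement is strictly smaller,
   and as a retract it stays unnested. *)
have step A : (0 < ladder_size A)%N ->
    (forall K, decomposable K -> decomposable (ladder_oplus A K)) ->
    splits_off L A -> decomposable L.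
  move=> A0 hA [K [LK VK WK sV sW]]; apply: (decomposable_iso LK); apply/hA.
  apply: IH; [|exact: retract_unnested VK nV|exact: retract_unnested WK nW].
  rewrite ltnS in ltLn; apply: leq_trans ltLn.
  apply: leq_trans (leq_add sV sW).
  by rewrite addnACA -addn1 leq_add2l.
have sI (b : pinterval l) := pm_size_interval F b.
have [/existsP nzV|] := boolP [exists k, {:lad_V L k}%VS != 0%VS].
  case: (split_plus_or_R nV nW nzV) => [[b]|[p]]; apply: step.
  - by rewrite /ladder_size addn_gt0 sI.
  - exact: decomposable_plus.
  - by rewrite /ladder_size addn_gt0 sI.
  - exact: decomposable_R.
rewrite negb_exists => /forallP V0.
have {}V0 k : {:lad_V L k}%VS = 0%VS := eqP (negbNE (V0 k)).
have [/existsP nzW|] := boolP [exists k, {:lad_W L k}%VS != 0%VS].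
  have [b] := split_minus V0 nzW; apply: step; last exact: decomposable_minus.
  by rewrite /ladder_size addn_gt0 sI orbT.
rewrite negb_exists => /forallP W0.
have {}W0 k : {:lad_W L k}%VS = 0%VS := eqP (negbNE (W0 k)).
apply: decomposable_iso decomposable_zero.
do 2!eexists; split; [exact: pmiso_zero|exact: pmiso_zero|move=> k].
by rewrite comp_lfun0l comp_lfun0r.
Qed.

End LadderDecomposition.

Theorem theorem4p3 (F : fieldType) (l : nat) (L : ladder F l)
    (hV : no_strictly_nested_bars (lad_V L))
    (hW : no_strictly_nested_bars (lad_W L)) :
  exists (r : preceq_pair l -> nat) (dplus dminus : pinterval l -> nat),
    ladder_iso L
      (ladder_oplus
        (ladder_oplus
          (\big[@ladder_oplus F l/ladder_zero F l]_(p : preceq_pair l)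
             ladder_pow (ladder_R F p) (r p))
          (\big[@ladder_oplus F l/ladder_zero F l]_(b : pinterval l)
             ladder_pow (ladder_plus F b) (dplus b)))
        (\big[@ladder_oplus F l/ladder_zero F l]_(b : pinterval l)
           ladder_pow (ladder_minus F b) (dminus b))).
Proof.
exact: unnested_decomposable (no_nested_unnested hV) (no_nested_unnested hW).
Qed.
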